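(* Let $AX_*=B$ be a class of linear systems where $A\in\mathbb{R}^{n\times n}$ is symmetric positive definite and $X_*\sim\mu_0=\mathcal{N}(x_0,\Sigma_0)$. Let $\mu_m=\mathcal{N}(x_m,\Sigma_m)$, $1\le m\le n$, be the posterior distributions from a probabilistic solver under the prior $\mu_0$ applied to $AX_*=B$. If the solver is calibrated, then $$\mathbb{E}\left[\|X_*-x_m\|_A^2\right]=\operatorname{trace}(A\Sigma_m),\qquad 1\le m\le n.$$
   Context: $\mathcal{N}(x,\Sigma)$ is the Gaussian distribution on $\mathbb{R}^n$ with mean $x$ and (possibly singular) covariance $\Sigma$; $\|x\|_A=\|A^{1/2}x\|_2$. A probabilistic linear solver under the prior $\mu_0=\mathcal{N}(x_0,\Sigma_0)$, applied to the system $AX_*=B$ with random right-hand side $B=AX_*$, computes from $A$, $B$ and $\mu_0$ posterior means $x_m\in\mathbb{R}^n$ and symmetric positive semi-definite posterior covariances $\Sigma_m\in\mathbb{R}^{n\times n}$, giving posteriors $\mu_m=\mathcal{N}(x_m,\Sigma_m)$, $1\le m\le n$. The means $x_m$ may depend on $B$ and hence are in general random. Calibration: let $p_m=\operatorname{rank}(\Sigma_m)$ and let $U=[U_m\ \ U_m^\perp]\in\mathbb{R}^{n\times n}$ be an orthogonal eigenvector matrix of $\Sigma_m$ with $U_m\in\mathbb{R}^{n\times p_m}$, $U_m^\perp\in\mathbb{R}^{n\times(n-p_m)}$, $\operatorname{range}(U_m)=\operatorname{range}(\Sigma_m)$ and $\operatorname{range}(U_m^\perp)=\ker(\Sigma_m)$.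 The solver is calibrated if all posterior covariances $\Sigma_m$ are independent of $B$ (that is, nonrandom) and, for $1\le m\le n$, $$(U_m^T\Sigma_mU_m)^{-1/2}U_m^T(X_*-x_m)\sim\mathcal{N}(0,I_{p_m}),\qquad (U_m^\perp)^T(X_*-x_m)=0\ \text{(almost surely)}.$$ *)

(* Defs.v *)
From mathcomp Require Export all_boot all_order all_algebra.
From mathcomp Require Export all_classical all_reals all_analysis.

Set Implicit Arguments.
Unset Strict Implicit.
Unset Printing Implicit Defensive.

Import Order.TTheory GRing.Theory Num.Theory.

Local Open Scope classical_set_scope.
Local Open Scope ring_scope.

Definition spdmx (R : realType) (n : nat) (A : 'M[R]_n) : Prop :=
  A^T = A /\ forall x : 'cV[R]_n, x != 0 -> 0 < (x^T *m A *m x) 0 0.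

Definition psdmx (R : realType) (n : nat) (A : 'M[R]_n) : Prop :=
  A^T = A /\ forall x : 'cV[R]_n, 0 <= (x^T *m A *m x) 0 0.

(* The square root is the (unique) symmetric positive semi-definite S with
   S *m S = A; the default 0 is only returned when there is none, that is, when
   A is not symmetric positive semi-definite. *)
Definition sqrtmx (R : realType) (n : nat) (A : 'M[R]_n) : 'M[R]_n :=
  xget 0 [set S | psdmx S /\ S *m S = A].

(* The library norm `|x| on 'cV[R]_n is the sup norm. *)
Definition norm2 (R : realType) (n : nat) (x : 'cV[R]_n) : R :=
  Num.sqrt (\sum_i x i 0 ^+ 2).

Definition energy_norm (R : realType) (n : nat) (A : 'M[R]_n) (x : 'cV[R]_n) : R :=
  norm2 (sqrtmx A *m x).

(* The parameters of a Gaussian distribution on R^n, possibly singular. *)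
Record gaussian (R : realType) (n : nat) := Gaussian {
  gmean : 'cV[R]_n ;
  gcov : 'M[R]_n ;
  gcov_psd : psdmx gcov }.

Lemma psdmx1 (R : realType) (n : nat) : psdmx (1%:M : 'M[R]_n).
Proof.
split=> [|x]; first by rewrite trmx1.
by rewrite mulmx1 mxE sumr_ge0 // => i _; rewrite mxE -expr2 sqr_ge0.
Qed.

Definition std_gaussian (R : realType) (n : nat) : gaussian R n :=
  Gaussian 0 (psdmx1 R n).

Definition random_vector (d : measure_display) (T : measurableType d)
    (R : realType) (n : nat) (X : T -> 'cV[R]_n) : Prop :=
  forall i, measurable_fun setT (fun t => X t i 0).

(* The univariate law with mean m and variance v >= 0. The second argument of
   normal_prob is a standard deviation, and normal_prob m 0 is the uniform law
   on [0, 1] rather than the Dirac mass at m. *)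
Definition gaussian1 (R : realType) (m v : R) : set R -> \bar R :=
  if v == 0 then dirac m else normal_prob m (Num.sqrt v).

(* X ~ N(mu, S), S possibly singular: every linear functional w^T X has the
   univariate Gaussian law with mean w^T mu and variance w^T S w. *)
Definition has_gaussian_law (d : measure_display) (T : measurableType d)
    (R : realType) (P : probability T R) (n : nat) (X : T -> 'cV[R]_n)
    (g : gaussian R n) : Prop :=
  random_vector X /\
  forall (w : 'cV[R]_n) (E : set R), measurable E ->
    P ((fun t => (w^T *m X t) 0 0) @^-1` E) =
    gaussian1 ((w^T *m gmean g) 0 0) ((w^T *m gcov g *m w) 0 0) E.

(* A solver maps the matrix A, the right-hand side b, the prior and the
   iteration number m to the posterior. *)
Definition prob_solver (R : realType) (n : nat) : Type :=
  'M[R]_n -> 'cV[R]_n -> gaussian R n -> nat -> gaussian R n.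

(* U = [Um Up] is an orthogonal eigenvector matrix of S with
   range(Um) = range(S) and range(Up) = ker(S). Column spaces are expressed as
   row spaces of transposes. The width of U is \rank S + (n - \rank S), which
   is not convertible to n, hence the two-sided orthogonality condition. *)
Definition eigenvector_split (R : realType) (n : nat) (S : 'M[R]_n)
    (Um : 'M[R]_(n, \rank S)) (Up : 'M[R]_(n, n - \rank S)) : Prop :=
  let U := row_mx Um Up in
  [/\ U^T *m U = 1%:M, U *m U^T = 1%:M,
      exists l : 'rV[R]_(\rank S + (n - \rank S)), S *m U = U *m diag_mx l,
      (Um^T == S^T)%MS &
      (Up^T == kermx S^T)%MS].

(* The choice of U is immaterial: two choices differ by an orthogonal change
   of basis of range(S) and of ker(S), and N(0, I) is rotation invariant. *)
Definition calibrated (d : measure_display) (T : measurableType d)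
    (R : realType) (P : probability T R) (n : nat) (A : 'M[R]_n)
    (X B : T -> 'cV[R]_n) (mu0 : gaussian R n) (solver : prob_solver R n) : Prop :=
  forall m : nat, (1 <= m <= n)%N ->
  let x t := gmean (solver A (B t) mu0 m) in
  exists S : 'M[R]_n,
    (forall t, gcov (solver A (B t) mu0 m) = S) /\
    exists (Um : 'M[R]_(n, \rank S)) (Up : 'M[R]_(n, n - \rank S)),
      [/\ eigenvector_split Um Up,
          has_gaussian_law P
            (fun t => invmx (sqrtmx (Um^T *m S *m Um)) *m Um^T *m (X t - x t))
            (std_gaussian R (\rank S)) &
          {ae P, forall t, Up^T *m (X t - x t) = 0}].

(* Main.v *)
Require Import Defs.
From mathcomp Require Import measurable_realfun ring.
From mathcomp Require Import complex spectral mxpoly sesquilinear.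

(** Write Z = X - x_m for the error and C for the square root of A. Then
    ||Z||_A^2 = |C Z|^2 = sum_k (C_k Z)^2,
where C_k is the k-th row of C, so that it is enough to know the second moment
of one linear functional a Z of the error. Let S be the posterior covariance,
Um an orthonormal eigenbasis of range S and Q the square root of Um^T S Um.
Calibration says that the component of Z in ker S vanishes almost surely and
that Y = Q^-1 Um^T Z is a standard Gaussian vector, so that Z = Um Q Y almost
surely. Hence a Z is almost surely a linear functional w Y of
Y, and E (a Z)^2 = |w|^2 = a S a^T (calibrated_error_second_moment). Summing
over the rows of C,
    E ||Z||_A^2 = sum_k C_k S C_k^T = trace (C S C) = trace (A S).
All summands are nonnegative, so the sum leaves the expectation without any
integrability condition, and mixed moments of Y never appear: by definition of
a Gaussian vector w Y has a univariate normal law, or is null when w = 0.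

Two general facts support this. A positive semi-definite matrix has a positive
semi-definite square root (psdmx_sqrt_exists), which is what makes the matrices
C and Q, defined by a choice, into actual roots. The second moment of the
centred normal law of standard deviation s is s^2 (normal_pdf_second_moment),
by integration by parts on [0, k] and monotone convergence as k grows. *)

Set Implicit Arguments.
Unset Strict Implicit.
Unset Printing Implicit Defensive.

Import Order.TTheory GRing.Theory Num.Theory.
Import numFieldNormedType.Exports.

Local Open Scope classical_set_scope.
Local Open Scope ring_scope.

(** * Square roots of positive semi-definite matrices *)

(** Diagonalising A over the complex numbers, where the spectral theorem for
hermitian matrices applies, gives real diagonal entries l j. The eigenvector
matrix stays complex, so what is brought back to the reals is the part that
does not mention it: the l j are eigenvalues of A, and a real polynomial in A
is determined by its values at the l j. *)
Lemma symmx_real_spectrum (R : realType) (n : nat) (A : 'M[R]_n.+1) :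
  A^T = A ->
  exists l : 'I_n.+1 -> R, (forall j, eigenvalue A (l j)) /\
    forall p : {poly R}, (forall j, p.[l j] = 0) -> horner_mx A p = 0.
Proof.
move=> symA; pose toC : {rmorphism R -> complex R} := real_complex_def (Phant R).
pose AC := map_mx toC A.
have hermA : AC \is hermsymmx.
  apply: realsym_hermsym.
    apply/is_hermitianmxP.
    by rewrite expr0 scale1r map_mx_id// map_trmx symA.
  by apply/mxOverP => i j; rewrite mxE; apply/complex_realP; exists (A i j).
have /orthomx_spectralP ACE := hermitian_normalmx hermA.
set V := spectralmx AC in ACE; set D := spectral_diag AC in ACE.
have unitV : V \is a GRing.unit by exact: spectral_unit.
have realD : D \is a mxOver Num.real by exact: hermitian_spectral_diag_real.
have DE j : exists k, D 0 j = toC k by apply/complex_realP/(mxOverP realD).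
have [l Dl] := choice DE; exists l; split=> [j|p pl].
  rewrite -(eigenvalue_map toC) -/AC; apply/eigenvalueP; rewrite -Dl.
  exists (row j V).
    rewrite ACE !mulmxA -row_mul mulmxV// row1 -rowE row_diag_mx.
    by rewrite -scalemxAl -rowE.
  apply/eqP => /(congr1 (mulmx^~ (invmx V))).
  rewrite -row_mul mulmxV// row1 mul0mx => /matrixP/(_ 0 j).
  by rewrite !mxE !eqxx; apply/eqP; rewrite oner_eq0.
have : map_mx toC (horner_mx A p) = 0.
  rewrite map_horner_mx/= -/AC ACE horner_mx_uconjC// horner_mx_diag.
  suff -> : map_mx (horner (map_poly toC p)) D = 0.
    by rewrite raddf0 mulmx0 mul0mx.
  by apply/matrixP => i j; rewrite !mxE ord1 Dl horner_map/= pl rmorph0.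
by move=> /eqP; rewrite map_mx_eq0 => /eqP.
Qed.

Lemma psdmx_eigenvalue_ge0 (R : realType) (n : nat) (A : 'M[R]_n) (a : R) :
  psdmx A -> eigenvalue A a -> 0 <= a.
Proof.
move=> [symA psdA] /eigenvalueP[v vA v0].
have := psdA v^T; rewrite trmxK vA -scalemxAl mxE.
have vv : 0 < (v *m v^T) 0 0.
  have sq k : 0 <= v 0 k * v^T k 0 by rewrite mxE -expr2 sqr_ge0.
  rewrite mxE lt0r sumr_ge0 // andbT; apply: contraNneq v0.
  move=> /eqP; rewrite psumr_eq0// => /allP v0.
  apply/eqP/rowP => j; have /= := v0 j (mem_index_enum j).
  by rewrite !mxE -expr2 sqrf_eq0 => /eqP.
by rewrite pmulr_lge0.
Qed.

Lemma poly_interpolation (F : fieldType) (s : seq F) (f : F -> F) :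
  exists p : {poly F}, {in s, forall x, p.[x] = f x}.
Proof.
elim: s => [|x s [p pf]]; first by exists 0.
have [xs|xs] := boolP (x \in s).
  by exists p => y; rewrite inE => /predU1P[->|]; exact: pf.
pose q := \prod_(y <- s) ('X - y%:P).
have qx : q.[x] != 0.
  by apply: contra xs => qx; rewrite -root_prod_XsubC.
exists (p + ((f x - p.[x]) / q.[x]) *: q) => y.
rewrite inE hornerD hornerZ => /predU1P[->|ys].
  by rewrite divfK// subrKC.
have /rootP -> : root q y by rewrite root_prod_XsubC.
by rewrite mulr0 addr0 pf.
Qed.

Lemma trmx_horner_mx (R : comNzRingType) (n : nat) (A : 'M[R]_n.+1)
  (p : {poly R}) : (horner_mx A p)^T = horner_mx A^T p.
Proof.
elim/poly_ind: p => [|p c IHp]; first by rewrite !rmorph0 trmx0.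
rewrite !rmorphD !rmorphM/= !horner_mx_X !horner_mx_C raddfD/= tr_scalar_mx.
rewrite trmx_mul IHp; congr (_ + _).
by apply: esym; apply: comm_horner_mx.
Qed.

(** A polynomial r with r(a) = a^(1/4) on the spectrum of A gives a real
symmetric matrix H = r(A) with H^4 = A, because r^4 agrees with X on the
spectrum. The square root is H^2, and it is taken as a square so that
its positivity reads x^T H^2 x = |H x|^2. *)
Lemma psdmx_sqrt_exists (R : realType) (n : nat) (A : 'M[R]_n) :
  psdmx A -> exists S, psdmx S /\ S *m S = A.
Proof.
case: n A => [|n] A psdA.
  (* Polynomials in a matrix require positive size; a 0 x 0 matrix is its own
     root. *)
  by exists A; split=> //; apply/matrixP => -[].
have [symA _] := psdA.
have [l [eigl l_annihilates]] := symmx_real_spectrum symA.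
have [r rl] :=
  poly_interpolation (codom l) (fun x => Num.sqrt (Num.sqrt x)).
pose H := horner_mx A r.
have symH : H^T = H by rewrite /H trmx_horner_mx symA.
exists (H *m H); split; first split.
- by rewrite trmx_mul symH.
- move=> x; rewrite mulmxA -mulmxA -{1}symH -trmx_mul mxE sumr_ge0// => i _.
  by rewrite mxE -expr2 sqr_ge0.
- suff : horner_mx A (r ^+ 4 - 'X) = 0.
    rewrite rmorphB/= horner_mx_X rmorphXn/= -/H => /subr0_eq <-.
    by rewrite mulmxE -!expr2 -exprM.
  apply: l_annihilates => j; rewrite hornerD hornerN hornerX horner_exp.
  rewrite rl ?codom_f// (exprM _ 2 2) !sqr_sqrtr ?sqrtr_ge0 ?subrr//.
  exact: psdmx_eigenvalue_ge0 (eigl j).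
Qed.

Lemma sqrtmxP (R : realType) (n : nat) (A : 'M[R]_n) :
  psdmx A -> psdmx (sqrtmx A) /\ sqrtmx A *m sqrtmx A = A.
Proof. by move=> /psdmx_sqrt_exists sqrtA; exact: (xgetPex 0 sqrtA). Qed.

(** * The second moment of a centred normal law *)

(** The change of variables holds for the Radon-Nikodym derivative, which by
uniqueness agrees with the density outside a Lebesgue-null set. *)
Lemma ge0_integral_normal_prob (R : realType) (m s : R) (f : R -> \bar R) :
  (forall x, 0 <= f x)%E -> measurable_fun [set: R] f ->
  (\int[normal_prob m s]_x f x =
   \int[lebesgue_measure]_x (f x * (normal_pdf m s x)%:E))%E.
Proof.
move=> f0 mf; have dom := normal_prob_dominates m s.
rewrite -(Radon_Nikodym_SigmaFinite.change_of_variables dom f0)//.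
have fi := Radon_Nikodym_SigmaFinite.f_integrable dom.
have mp : measurable_fun [set: R] (EFin \o normal_pdf m s).
  by apply/measurable_EFinP; exact: measurable_normal_pdf.
apply: ae_eq_integral => //.
- by apply: emeasurable_funM => //; exact: measurable_int fi.
- exact: emeasurable_funM.
apply: ae_eqe_mul2l; apply: integral_ae_eq => //.
by move=> E _ mE; rewrite -Radon_Nikodym_SigmaFinite.f_integral.
Qed.

Section normal_second_moment.
Context {R : realType} (s : R) (s0 : s != 0).
Local Notation mu := (@lebesgue_measure R).
Local Notation p := (normal_pdf 0 s).

Let pE x : p x = normal_peak s * expR (- x ^+ 2 / (s ^+ 2 *+ 2)).
Proof. by rewrite normal_pdfE// /normal_fun subr0. Qed.

Let p_even x : p (- x) = p x.
Proof. by rewrite !pE sqrrN. Qed.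

Let s2_neq0 : s ^+ 2 *+ 2 != 0.
Proof. by rewrite mulrn_eq0/= sqrf_eq0. Qed.

Let is_derive_pdf (x : R) : is_derive x 1 p (- (x / s ^+ 2 * p x)).
Proof.
have -> : p = (fun x => normal_peak s * expR (- x ^+ 2 / (s ^+ 2 *+ 2))).
  by apply/funext => y; exact: pE.
apply: is_derive_eq => /=.
rewrite /GRing.scale/= !mulr0 add0r.
by field.
Qed.

Let pdf_continuous : continuous p.
Proof. exact: continuous_normal_pdf. Qed.

(** The boundary term of the integration by parts: exp(-y) <= 1/y with
y = k^2 / (2 s^2) bounds k p(k) by a multiple of 1/k. *)
Let cvg_npdf : n.+1%:R * p n.+1%:R @[n --> \oo] --> (0 : R).
Proof.
apply: (@squeeze_cvgr _ _ _ _ (cst 0)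
  (fun n => (normal_peak s * (s ^+ 2 *+ 2)) * harmonic n)).
- apply: nearW => n; rewrite mulr_ge0 ?normal_pdf_ge0//=.
  rewrite pE /harmonic.
  set k : R := n.+1%:R; have k0 : 0 < k by rewrite ltr0n.
  have c0 : 0 < s ^+ 2 *+ 2 by rewrite lt0r s2_neq0 mulrn_wge0 ?sqr_ge0.
  rewrite mulrCA -mulrA ler_pM2l ?normal_peak_gt0//.
  rewrite mulNr expRN ler_pdivrMr ?expR_gt0// mulrAC ler_pdivlMr//.
  rewrite -expr2 -ler_pdivrMl// mulrC.
  by apply: le_trans (expR_ge1Dx _); rewrite lerDr.
- exact: cvg_cst.
- rewrite -[X in _ --> X](mulr0 (normal_peak s * (s ^+ 2 *+ 2))).
  by apply: cvgM; [exact: cvg_cst|exact: cvg_harmonic].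
Qed.

Local Open Scope ereal_scope.

(** Half of the total mass, as p is even. *)
Let half_integral_pdf : \int[mu]_(x in `[0%R, +oo[) (p x)%:E = (2^-1)%:E.
Proof.
have := integral_normal_pdf 0 s.
rewrite ge0_symfun_integralT//=; last 2 first.
- by move=> x; exact: normal_pdf_ge0.
- by move=> x /=; rewrite p_even.
rewrite -set_itvcy => /(congr1 (fun y => (2^-1)%:E * y)).
by rewrite muleA -EFinM mulVf// mul1e mule1.
Qed.

(** Integration by parts with the factors x and x p(x), the latter having the
primitive -s^2 p(x). The upper bound is a successor so that the interval is not
reduced to a point. *)
Let truncated_second_moment n :
  \int[mu]_(x in `[0%R, n.+1%:R]) (x ^+ 2 * p x)%:E =
  (- s ^+ 2 * (n.+1%:R * p n.+1%:R))%:E +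
  (s ^+ 2)%:E * \int[mu]_(x in `[0%R, n.+1%:R]) (p x)%:E.
Proof.
have G' (x : R) : is_derive x 1%R (fun x => - s ^+ 2 * p x)%R (x * p x)%R.
  have pd := is_derive_pdf x.
  by apply: is_derive_eq; rewrite /GRing.scale/=; field.
have Gcont : continuous (fun x => - s ^+ 2 * p x)%R.
  by move=> x; apply: cvgM; [exact: cvg_cst|exact: pdf_continuous].
have G'E := fun x => @derive_val _ _ _ _ _ _ _ (G' x).
have -> : \int[mu]_(x in `[0%R, n.+1%:R]) (x ^+ 2 * p x)%:E =
    \int[mu]_(x in `[0%R, n.+1%:R]) (id x * (x * p x))%:E.
  by apply: eq_integral => x _; rewrite mulrA expr2.
rewrite (@integration_by_parts R id (fun x => - s ^+ 2 * p x)%R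
  (cst 1%R) (fun x => x * p x)%R) ?ltr0n//; last first.
- by move=> x _; rewrite derive1E G'E.
- split; first by move=> x _; exact: (@ex_derive _ _ _ _ _ _ _ (G' x)).
    exact/cvg_at_right_filter/Gcont.
  exact/cvg_at_left_filter/Gcont.
- apply: continuous_subspaceT => x.
  by apply: cvgM; [exact: cvg_id|exact: pdf_continuous].
- by move=> x _; rewrite derive1E derive_id.
- by split=> //;
    [exact/cvg_at_right_filter/cvg_id|exact/cvg_at_left_filter/cvg_id].
- by apply: continuous_subspaceT => x; exact: cvg_cst.
rewrite mul0r subr0 mulrCA; congr (_ + _).
have -> : \int[mu]_(x in `[0%R, n.+1%:R]) (cst 1%R x * (- s ^+ 2 * p x))%:E =
    (- s ^+ 2)%:E * \int[mu]_(x in `[0%R, n.+1%:R]) (p x)%:E.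
  rewrite -integralZl//; last first.
    by apply: integrableS (integrable_normal_pdf 0 s).
  by apply: eq_integral => x _; rewrite /= mul1r.
by rewrite EFinN mulNe oppeK.
Qed.

Let half_second_moment :
  \int[mu]_(x in `[0%R, +oo[) (x ^+ 2 * p x)%:E = (s ^+ 2 / 2)%:E.
Proof.
have p0 := normal_pdf_ge0 0 s; have mp := measurable_normal_pdf 0 s.
have x2p0 (x : R) : (0 <= x ^+ 2 * p x)%R by rewrite mulr_ge0 ?sqr_ge0.
have mx2p : measurable_fun [set: R] (fun x => x ^+ 2 * p x)%R.
  by apply: measurable_funM => //; exact: measurable_funX.
have := @ge0_cvgn_integral R mu _ x2p0 mx2p.
rewrite -cvg_shiftS => /cvg_lim <- //.
apply/cvg_lim => //=; under eq_fun do rewrite truncated_second_moment.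
rewrite -[(s ^+ 2 / 2)%:E]add0e; apply: cvgeD => //.
  apply: cvg_EFin; first exact: nearW.
  rewrite -[X in _ --> X](mulr0 (- s ^+ 2)%R).
  by apply: cvgM; [exact: cvg_cst|exact: cvg_npdf].
rewrite (EFinM (s ^+ 2)%R); apply: cvgeZl => //; rewrite -half_integral_pdf.
have := @ge0_cvgn_integral R mu _ p0 mp.
by rewrite -cvg_shiftS.
Qed.

Lemma normal_pdf_second_moment :
  \int[mu]_x (x ^+ 2 * p x)%:E = (s ^+ 2)%:E.
Proof.
rewrite (ge0_symfun_integralT (f := fun x => x ^+ 2 * p x)%R).
- by rewrite -set_itvcy half_second_moment -EFinM mulrC divfK.
- by move=> x; rewrite mulr_ge0 ?sqr_ge0 ?normal_pdf_ge0.
- by move=> x; apply: cvgM; [exact: exprn_continuous|exact: pdf_continuous].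
- by move=> x /=; rewrite sqrrN p_even.
Qed.

End normal_second_moment.

(** The degenerate case v = 0 is separate: the law is then a Dirac mass, which
has no density. *)
Lemma gaussian_law_second_moment (d : measure_display) (T : measurableType d)
    (R : realType) (P : probability T R) (Y : T -> R) (v : R) :
  0 <= v -> measurable_fun setT Y ->
  (forall E, measurable E -> P (Y @^-1` E) = gaussian1 0 v E) ->
  (\int[P]_t (Y t ^+ 2)%:E = v%:E)%E.
Proof.
move=> v0 mY lawY; pose GR := measurableTypeR R.
(* The normal law lives on GR, whose measurable sets are those of R under
   another display. *)
have mY' : measurable_fun [set: T] (Y : T -> GR) by exact: mY.
have msq : measurable_fun [set: GR] (fun x : GR => (x ^+ 2)%:E).
  by apply/measurable_EFinP; exact: measurable_funX.
have sq0 (x : R) : (0 <= (x ^+ 2)%:E)%E by rewrite lee_fin sqr_ge0.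
transitivity (\int[pushforward P (Y : T -> GR)]_x (x ^+ 2)%:E)%E.
  by rewrite ge0_integral_pushforward.
have [v_eq0|v_neq0] := eqVneq v 0.
  rewrite (@eq_measure_integral _ _ _ _ (dirac (0 : GR))); last first.
    by move=> E mE _; rewrite /= /pushforward lawY// /gaussian1 v_eq0 eqxx.
  by rewrite integral_dirac// diracT mul1e expr0n v_eq0.
rewrite (@eq_measure_integral _ _ _ _ (normal_prob 0 (Num.sqrt v))); last first.
  by move=> E mE _; rewrite /= /pushforward lawY// /gaussian1 (negbTE v_neq0).
rewrite ge0_integral_normal_prob//.
under eq_integral do rewrite -EFinM.
rewrite normal_pdf_second_moment ?sqr_sqrtr//.
by rewrite sqrtr_eq0 -ltNge lt0r v_neq0.
Qed.

(** * The energy norm of a calibrated error *)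

Lemma measurable_mulmx_row (d : measure_display) (T : measurableType d)
    (R : realType) (n : nat) (a : 'rV[R]_n) (Z : T -> 'cV[R]_n) :
  random_vector Z -> measurable_fun setT (fun t => (a *m Z t) 0 0).
Proof.
move=> mZ.
have -> : (fun t => (a *m Z t) 0 0) = (fun t => \sum_j (a 0 j * Z t j 0)).
  by apply/funext => t; rewrite mxE.
by apply: measurable_sum => j; apply: measurable_funM => //; exact: mZ.
Qed.

Lemma std_gaussian_second_moment (d : measure_display) (T : measurableType d)
    (R : realType) (P : probability T R) (p : nat) (Y : T -> 'cV[R]_p)
    (w : 'rV[R]_p) :
  has_gaussian_law P Y (std_gaussian R p) ->
  (\int[P]_t ((w *m Y t) 0 0 ^+ 2)%:E = ((w *m w^T) 0 0)%:E)%E.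
Proof.
move=> [mY lawY]; apply: gaussian_law_second_moment.
- by rewrite mxE sumr_ge0// => j _; rewrite mxE -expr2 sqr_ge0.
- exact: measurable_mulmx_row.
- by move=> E mE; have := lawY w^T E mE; rewrite trmxK/= mulmx0 mulmx1 mxE.
Qed.

(** As range(Up) = ker S and U is orthogonal, S = S U U^T = S Um Um^T, and the
columns of Um span an invariant subspace of S; so S is recovered from its
compression D = Um^T S Um. Hence rank S <= rank D, and D, of size rank S, is
invertible. *)
Lemma eigenvector_split_compression (R : realType) (n : nat) (S : 'M[R]_n)
    (Um : 'M[R]_(n, \rank S)) (Up : 'M[R]_(n, n - \rank S)) :
  eigenvector_split Um Up ->
  [/\ Um *m Um^T + Up *m Up^T = 1%:M,
      Um *m (Um^T *m S *m Um) *m Um^T = S &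
      Um^T *m S *m Um \in unitmx].
Proof.
move=> [UTU UUT [l SU] _ /andP[UpK _]].
have UUE : Um *m Um^T + Up *m Up^T = 1%:M.
  by rewrite -UUT tr_row_mx mul_row_col.
have UmUm : Um^T *m Um = 1%:M.
  move: UTU; rewrite tr_row_mx mul_col_row scalar_mx_block.
  by case/eq_block_mx.
have SUp : S *m Up = 0.
  by apply: trmx_inj; rewrite trmx_mul trmx0; apply/eqP; rewrite -sub_kermx.
have SUm : S *m Um = Um *m diag_mx (lsubmx l).
  move: SU; rewrite mul_mx_row -{1}(hsubmxK l) diag_mx_row mul_row_block.
  by rewrite !mulmx0 add0r addr0 => /eq_row_mx[].
have DE : Um *m (Um^T *m S *m Um) *m Um^T = S.
  rewrite -(mulmxA Um^T) SUm (mulmxA Um^T) UmUm mul1mx -SUm -mulmxA.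
  by rewrite -[RHS]mulmx1 -UUE mulmxDr [S *m (Up *m _)]mulmxA SUp mul0mx addr0.
split=> //; rewrite -row_free_unit /row_free eqn_leq rank_leq_row/=.
have := mxrankM_maxl (Um *m (Um^T *m S *m Um)) Um^T; rewrite DE => rkS.
exact: leq_trans rkS (mxrankM_maxr _ _).
Qed.

(** Both sides are the trace of C S C, by cyclicity of the trace. *)
Lemma sum_row_quadratic_forms (R : realType) (n : nat) (C S : 'M[R]_n) :
  C^T = C ->
  \sum_k (row k C *m S *m (row k C)^T) 0 0 = \tr (C *m C *m S).
Proof.
move=> symC; rewrite -[C *m C *m S]mulmxA mxtrace_mulC /mxtrace.
apply: eq_bigr => k _.
rewrite -row_mul !mxE; apply: eq_bigr => j _.
by rewrite !mxE -{2}symC mxE.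
Qed.

Lemma sqr_energy_norm (R : realType) (n : nat) (A : 'M[R]_n) (x : 'cV[R]_n) :
  energy_norm A x ^+ 2 = \sum_k (row k (sqrtmx A) *m x) 0 0 ^+ 2.
Proof.
rewrite /energy_norm /norm2 sqr_sqrtr ?sumr_ge0// => [|k _]; last first.
  exact: sqr_ge0.
by apply: eq_bigr => k _; rewrite -row_mul [in RHS]mxE.
Qed.

(** Let D = Um^T S Um, Q = D^(1/2), and let Y = Q^-1 Um^T Z be the standard
Gaussian vector of the calibration. Since Up^T Z = 0 almost surely,
Z = Um Um^T Z = Um Q Y almost surely, so a Z = w Y with w = a Um Q, and
E (w Y)^2 = |w|^2 = a Um D Um^T a^T = a S a^T. *)
Lemma calibrated_error_second_moment (d : measure_display) (T : measurableType d)
    (R : realType) (P : probability T R) (n : nat) (S : 'M[R]_n)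
    (Um : 'M[R]_(n, \rank S)) (Up : 'M[R]_(n, n - \rank S))
    (Z : T -> 'cV[R]_n) (a : 'rV[R]_n) :
  psdmx S -> random_vector Z -> eigenvector_split Um Up ->
  has_gaussian_law P
    (fun t => invmx (sqrtmx (Um^T *m S *m Um)) *m Um^T *m Z t)
    (std_gaussian R (\rank S)) ->
  {ae P, forall t, Up^T *m Z t = 0} ->
  (\int[P]_t ((a *m Z t) 0 0 ^+ 2)%:E = ((a *m S *m a^T) 0 0)%:E)%E.
Proof.
move=> psdS mZ /eigenvector_split_compression[UUE DE unitD].
set D := _ *m S *m Um in DE unitD *.
have psdD : psdmx D.
  have [symS psdS'] := psdS; split=> [|x].
    by rewrite /D !trmx_mul trmxK symS mulmxA.
  by have := psdS' (Um *m x); rewrite /D trmx_mul !mulmxA.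
(* From here on D is rewritten as an atom, not as a product involving S. *)
clearbody D.
have [[symQ _] QQ] := sqrtmxP psdD; set Q := sqrtmx D in symQ QQ *.
have unitQ : Q \in unitmx.
  by move: unitD; rewrite -QQ unitmx_mul => /andP[].
set Y := fun t => _ => lawY UpZ.
pose w := a *m Um *m Q.
transitivity (\int[P]_t ((w *m Y t) 0 0 ^+ 2)%:E)%E.
  have [mY _] := lawY.
  have msq (m : nat) (b : 'rV[R]_m) (V : T -> 'cV[R]_m) : random_vector V ->
      measurable_fun setT (fun t => ((b *m V t) 0 0 ^+ 2)%:E).
    move=> mV; apply/measurable_EFinP; apply: measurable_funX.
    exact: measurable_mulmx_row.
  apply: ae_eq_integral => //; [exact: msq|exact: msq|].
  apply: filterS UpZ => t UpZ _; suff -> : a *m Z t = w *m Y t by [].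
  rewrite -[Z t in LHS]mul1mx -UUE mulmxDl -[Up *m _ *m _]mulmxA UpZ.
  by rewrite mulmx0 addr0 /w /Y !mulmxA mulmxK.
rewrite std_gaussian_second_moment//; suff -> : w *m w^T = a *m S *m a^T by [].
have -> : a *m S *m a^T = a *m (Um *m D *m Um^T) *m a^T by rewrite DE.
by rewrite /w !trmx_mul symQ !mulmxA -(mulmxA _ Q Q) QQ.
Qed.

Theorem theorem31 (d : measure_display) (T : measurableType d) (R : realType)
    (P : probability T R) (n : nat) (A : 'M[R]_n) (mu0 : gaussian R n)
    (X B : T -> 'cV[R]_n) (solver : prob_solver R n)
    (A_spd : spdmx A)
    (X_law : has_gaussian_law P X mu0)
    (AXB : forall t, A *m X t = B t)
    (mean_rv : forall m : nat, (1 <= m <= n)%N ->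
       random_vector (fun t => gmean (solver A (B t) mu0 m)))
    (solver_cal : calibrated P A X B mu0 solver) :
  forall m : nat, (1 <= m <= n)%N -> forall t0 : T,
    ('E_P[fun t => (energy_norm A (X t - gmean (solver A (B t) mu0 m)) ^+ 2)%R] =
     (\tr (A *m gcov (solver A (B t0) mu0 m))%R)%:E)%E.
Proof.
move=> m mn t0; set Z := fun t => X t - gmean (solver A (B t) mu0 m).
have [S [covS [Um [Up [splitS lawY UpZ]]]]] := solver_cal m mn.
have psdS : psdmx S by rewrite -(covS t0); exact: gcov_psd.
have psdA : psdmx A.
  have [symA posA] := A_spd; split=> // x.
  have [->|/posA/ltW//] := eqVneq x 0.
  by rewrite mulmx0 mxE.
have [[symC _] CC] := sqrtmxP psdA.
have mZ : random_vector Z.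
  have [mX _] := X_law; move=> i.
  under eq_fun do rewrite !mxE.
  by apply: measurable_funB; [exact: mX|exact: mean_rv].
rewrite unlock covS.
under eq_integral do rewrite sqr_energy_norm -sumEFin.
rewrite ge0_integral_sum//; first last.
- by move=> k t _; rewrite lee_fin sqr_ge0.
- move=> k; apply/measurable_EFinP; apply: measurable_funX.
  exact: measurable_mulmx_row.
under eq_bigr do
  rewrite (calibrated_error_second_moment _ psdS mZ splitS lawY UpZ).
by rewrite sumEFin sum_row_quadratic_forms// CC.
Qed.
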